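(* Let $F$ be a distribution on $\mathbb{R}$ with a density, and let $X, X_1, X_2, \ldots$ be i.i.d. with distribution $F$, with mean $\mu = E[X]$. Suppose the tail $\bar F(x) = 1-F(x)$ satisfies $\bar F(x) = L(x)x^{-\alpha}$ for some slowly varying function $L$ and some $\alpha > 2$, and that $E|X|^{2+\delta}<\infty$ for some $\delta>0$. Let $\gamma=\gamma(n)$ satisfy $\gamma = n\mu + \omega(\sqrt{n\log n})$ as $n\to\infty$, and let the truncation level $u=u(n)$ satisfy $u \le \mu + O\big((\gamma-n\mu)/\sqrt{\log n}\big)$. Then, as $n\to\infty$, $$p(\tilde F_u) - p(F) = -p(F)(1+o(1)).$$
   Context: $S_n = X_1+\cdots+X_n$. For a distribution $G$ on $\mathbb{R}$, $p(G) = P_G(S_n>\gamma)$ denotes the probability that $S_n>\gamma$ when $X_1,\ldots,X_n$ are i.i.d. with distribution $G$. The truncated distribution $\tilde F_u$ is defined by $\tilde F_u(x) = F(x)/F(u)$ for $x\le u$ and $\tilde F_u(x)=1$ for $x>u$ (i.e., the law of $X$ conditioned on $X\le u$). Asymptotic notation: $a_n=o(b_n)$ means $a_n/b_n\to0$; $a_n=\omega(b_n)$ means $a_n/b_n\to\infty$; $a_n = O(b_n)$ means $|a_n/b_n|$ is bounded for all large $n$. *)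

(* Defs.v *)
From HB Require Import structures.
From mathcomp Require Import all_boot all_order all_algebra.
From mathcomp Require Import all_classical all_reals all_analysis.
Set Implicit Arguments. Unset Strict Implicit. Unset Printing Implicit Defensive.
Import Order.TTheory GRing.Theory Num.Theory.
Import numFieldNormedType.Exports.
Local Open Scope classical_set_scope.
Local Open Scope ring_scope.

Section Defs.
Variable R : realType.
Local Notation mu := (@lebesgue_measure R).

Definition is_density (f : R -> R) : Prop :=
  measurable_fun setT f /\ (forall x, 0 <= f x) /\
  (\int[mu]_x (f x)%:E = 1)%E.

Definition dens_cdf (f : R -> R) (x : R) : R :=
  fine (\int[mu]_(y in `]-oo, x]) (f y)%:E).

(* density of the truncated law  F~_u  (law of X conditioned on X <= u):
   F~_u(x) = F(x)/F(u) for x <= u, and 1 for x > u *)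
Definition trunc_density (f : R -> R) (u : R) (x : R) : R :=
  if x <= u then f x / dens_cdf f u else 0.

Definition conv (g h : R -> \bar R) (x : R) : \bar R :=
  (\int[mu]_y (g y * h (x - y)%R))%E.

(* dens_sum g k = density of X_1 + ... + X_(k+1), X_i i.i.d. with density g *)
Fixpoint dens_sum (g : R -> \bar R) (k : nat) : R -> \bar R :=
  match k with
  | 0 => g
  | k.+1 => conv (dens_sum g k) g
  end.

Definition ptail (f : R -> R) (n : nat) (gamma : R) : R :=
  match n with
  | 0 => if gamma < 0 then 1 else 0   (* S_0 = 0 *)
  | k.+1 => fine (\int[mu]_(x in `]gamma, +oo[) dens_sum (fun y => (f y)%:E) k x)
  end.

Definition slowly_varying (L : R -> R) : Prop :=
  measurable_fun setT L /\
  (exists A : R, forall x, A < x -> 0 < L x) /\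
  (forall lam : R, 0 < lam ->
     (fun x => L (lam * x) / L x) @ +oo --> (1 : R)).

End Defs.

(* Main.v *)
Require Import Defs.
From HB Require Import structures.
From mathcomp Require Import all_boot all_order all_algebra.
From mathcomp Require Import all_classical all_reals all_analysis.
From mathcomp Require Import measurable_realfun zify ring lra.
Import Order.TTheory GRing.Theory Num.Theory.
Import numFieldNormedType.Exports.
Local Open Scope classical_set_scope.
Local Open Scope ring_scope.

(** Put [x = gamma - n m] and [p = 2 + delta].  The truncated law has mean at
    most [m], and splitting its moment generating function at [|X - m| ~ 1/t]
    gives
      [E e^(t (X - m)) <= 1 + K t^2 (1 + t^delta e^(t (u - m)^+))].
    In Chernoff's bound take [t = A (ln x) / x]: the factor
    [t^delta e^(t (u - m)^+)] stays below 1 because [u - m = O(x / sqrt (ln n))],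
    and [n t^2 = o(ln x)] because [x / sqrt (n ln n)] tends to infinity, so the
    truncated tail is at most [x^-(A - 1)].  Conversely [p(F)] is bounded below
    by a fixed negative power of [x], since a single jump above [gamma + n^2]
    suffices when no other summand is below [-n], and regular variation makes
    the tail of [F] at least polynomial.  A large [A] concludes. *)

(** * Translation invariance of the Lebesgue integral *)

Section LebesgueShift.
Context {R : realType}.
Local Notation mu := (@lebesgue_measure R).
Local Open Scope ereal_scope.

(** The pushforward of Lebesgue measure under [x |-> x + a] gives half-open intervals their length,
    so uniqueness of Lebesgue measure identifies the two. *)
Lemma ge0_integral_shift (h : R -> \bar R) (a : R) :
  measurable_fun [set: R] h -> (forall x, 0 <= h x) ->
  \int[mu]_x h (x + a)%R = \int[mu]_x h x.
Proof.
move=> mh h0.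
have ms : measurable_fun [set: measurableTypeR R]
    ((fun x => x + a)%R : measurableTypeR R -> measurableTypeR R).
  exact: measurable_funD.
transitivity (\int[pushforward mu
    ((fun x => x + a)%R : measurableTypeR R -> measurableTypeR R)]_x h x).
  by rewrite ge0_integral_pushforward.
apply: eq_measure_integral => A mA _; apply/esym/lebesgue_measure_unique => //.
move=> _ [[b c]] _ <-; transitivity (mu `](b - a)%R, (c - a)%R]%classic).
  rewrite /= !lebesgue_measure_itv/= !lte_fin ltrD2r -!EFinB.
  by rewrite opprB addrA subrK.
congr (mu _); apply/seteqP.
by split => x; rewrite /= !in_itv/= ltrBlDr lerBrDr.
Qed.

End LebesgueShift.

(** * Convolutions of densities tested against nonnegative functions *)

Section Convolution.
Context {R : realType}.
Local Notation mu := (@lebesgue_measure R).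
Local Open Scope ereal_scope.
Implicit Types g h k : R -> \bar R.

Lemma conv_ge0 g h : (forall x, 0 <= g x) -> (forall x, 0 <= h x) ->
  forall x, 0 <= Defs.conv g h x.
Proof. by move=> g0 h0 x; apply: integral_ge0 => y _; exact: mule_ge0. Qed.

Lemma measurable_conv_kernel g h k :
  measurable_fun [set: R] g -> measurable_fun [set: R] h ->
  measurable_fun [set: R] k ->
  measurable_fun [set: R * R] (fun z : R * R => g z.2 * h (z.1 - z.2)%R * k z.1).
Proof.
move=> mg mh mk; apply: emeasurable_funM; first apply: emeasurable_funM.
- exact: (measurableT_comp mg).
- by apply: (measurableT_comp mh); exact: measurable_funB.
- exact: (measurableT_comp mk).
Qed.

Lemma measurable_conv g h :
  measurable_fun [set: R] g -> measurable_fun [set: R] h ->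
  (forall x, 0 <= g x) -> (forall x, 0 <= h x) ->
  measurable_fun [set: R] (Defs.conv g h).
Proof.
move=> mg mh g0 h0.
have mF : measurable_fun [set: measurableTypeR R * measurableTypeR R]
    (fun z : measurableTypeR R * measurableTypeR R => g z.2 * h (z.1 - z.2)%R).
  have := measurable_conv_kernel _ _ (cst 1) mg mh (measurable_cst _).
  by apply: eq_measurable_fun => z _; rewrite mule1.
have F0 (z : measurableTypeR R * measurableTypeR R) :
  0 <= g z.2 * h (z.1 - z.2)%R by exact: mule_ge0.
exact: (measurable_fun_fubini_tonelli_F (m2 := mu) _ mF F0).
Qed.

Lemma measurable_integral_shift h k :
  measurable_fun [set: R] h -> measurable_fun [set: R] k ->
  (forall x, 0 <= h x) -> (forall x, 0 <= k x) ->
  measurable_fun [set: R] (fun y => \int[mu]_z (h z * k (y + z)%R)).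
Proof.
move=> mh mk h0 k0.
have mF : measurable_fun [set: measurableTypeR R * measurableTypeR R]
    (fun z : measurableTypeR R * measurableTypeR R => h z.2 * k (z.1 + z.2)%R).
  apply: emeasurable_funM; first exact: (measurableT_comp mh).
  by apply: (measurableT_comp mk); exact: measurable_funD.
have F0 (z : measurableTypeR R * measurableTypeR R) :
  0 <= h z.2 * k (z.1 + z.2)%R by exact: mule_ge0.
exact: (measurable_fun_fubini_tonelli_F (m2 := mu) _ mF F0).
Qed.

(** Tonelli, followed by the translation [x = y + z] in the inner integral: for densities [g] and
    [h] this is [E k(Y + Z)] with [Y] and [Z] independent. *)
Lemma integral_conv g h k :
  measurable_fun [set: R] g -> measurable_fun [set: R] h ->
  measurable_fun [set: R] k ->
  (forall x, 0 <= g x) -> (forall x, 0 <= h x) -> (forall x, 0 <= k x) ->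
  \int[mu]_x (Defs.conv g h x * k x) =
  \int[mu]_y (g y * \int[mu]_z (h z * k (y + z)%R)).
Proof.
move=> mg mh mk g0 h0 k0.
have mF : measurable_fun [set: measurableTypeR R * measurableTypeR R]
    (fun z : measurableTypeR R * measurableTypeR R =>
       g z.2 * h (z.1 - z.2)%R * k z.1).
  exact: measurable_conv_kernel.
have F0 (z : measurableTypeR R * measurableTypeR R) :
  0 <= g z.2 * h (z.1 - z.2)%R * k z.1 by rewrite !mule_ge0.
have mshift y : measurable_fun [set: R] (fun x => h (x - y)%R).
  by apply: (measurableT_comp mh); exact: measurable_funB.
transitivity (\int[mu]_x \int[mu]_y (g y * h (x - y)%R * k x)).
  apply: eq_integral => x _; rewrite -ge0_integralZr//.
    apply: emeasurable_funM => //; apply: (measurableT_comp mh).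
    exact: measurable_funB.
  by move=> y _; exact: mule_ge0.
have /= -> := fubini_tonelli (m1 := mu) (m2 := mu) _ mF F0.
apply: eq_integral => y _; rewrite -ge0_integralZl//; last 2 first.
- apply: emeasurable_funM => //; apply: (measurableT_comp mk).
  exact: measurable_funD.
- by move=> x _; exact: mule_ge0.
rewrite -(ge0_integral_shift _ y).
- by apply: eq_integral => x _; rewrite addrK muleA (addrC y).
- by apply: emeasurable_funM => //; exact: emeasurable_funM.
- by move=> x; rewrite !mule_ge0.
Qed.

Variable g : R -> \bar R.
Hypotheses (mg : measurable_fun [set: R] g) (g0 : forall x, 0 <= g x).

Lemma dens_sum_ge0 n x : 0 <= dens_sum g n x.
Proof. by elim: n x => //= n IH x; exact: conv_ge0. Qed.

Lemma measurable_dens_sum n : measurable_fun [set: R] (dens_sum g n).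
Proof.
by elim: n => //= n IH; apply: measurable_conv => // x; exact: dens_sum_ge0.
Qed.

(** Splits off the last summand. With [k] exponential it makes the moment generating function
    multiplicative; with [k] the indicator of a half-line it drives the one-big-jump induction. *)
Lemma integral_dens_sumS n k :
  measurable_fun [set: R] k -> (forall x, 0 <= k x) ->
  \int[mu]_x (dens_sum g n.+1 x * k x) =
  \int[mu]_y (dens_sum g n y * \int[mu]_z (g z * k (y + z)%R)).
Proof.
move=> mk k0; apply: integral_conv => //; first exact: measurable_dens_sum.
exact: dens_sum_ge0.
Qed.

(** By independence, one factor per summand; the exponent is [n.+1] because [dens_sum g n] belongs
    to a sum of [n + 1] variables. *)
Lemma integral_dens_sum_expR n (t : R) :
  \int[mu]_x (dens_sum g n x * (expR (t * x))%:E) =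
  (\int[mu]_x (g x * (expR (t * x))%:E)) ^+ n.+1.
Proof.
have me : measurable_fun [set: R] (fun x : R => (expR (t * x))%:E).
  apply/measurable_EFinP; apply: (measurableT_comp (@measurable_expR R)).
  exact: (@mulrl_measurable R).
have e0 x : 0 <= (expR (t * x))%:E by rewrite lee_fin expR_ge0.
have M0 : 0 <= \int[mu]_x (g x * (expR (t * x))%:E).
  by apply: integral_ge0 => x _; exact: mule_ge0.
elim: n => [|n IH]; first by rewrite expeS expe0 mule1.
rewrite integral_dens_sumS; [|exact: me|exact: e0].
rewrite expeS -IH [RHS]muleC -ge0_integralZr; last 4 first.
- exact: measurableT.
- by apply: emeasurable_funM => //; exact: measurable_dens_sum.
- by move=> x _; rewrite mule_ge0// dens_sum_ge0.
- exact: M0.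
apply: eq_integral => y _; rewrite -muleA; congr (_ * _).
rewrite -ge0_integralZl; last 4 first.
- exact: measurableT.
- exact: emeasurable_funM.
- by move=> x _; exact: mule_ge0.
- exact: e0.
by apply: eq_integral => z _; rewrite mulrDr expRD EFinM muleCA.
Qed.

End Convolution.

(** * Chernoff and one-big-jump bounds for tails of sums *)

Section Tails.
Context {R : realType}.
Local Notation mu := (@lebesgue_measure R).
Local Open Scope ereal_scope.

Lemma integral_indicM (D : set R) (g : R -> \bar R) :
  \int[mu]_(x in D) g x = \int[mu]_x (g x * (\1_D x)%:E).
Proof.
rewrite integral_mkcond; apply: eq_integral => x _; rewrite patchE indicE.
by case: (x \in D); rewrite ?mule1 ?mule0.
Qed.

Lemma indic_itvoy (a x : R) : \1_(`]a, +oo[) x = (a < x)%R%:R :> R.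
Proof.
rewrite indicE; congr (_ %:R)%R; apply: congr1.
by apply/idP/idP; rewrite inE/= in_itv/= andbT.
Qed.

Lemma measurable_indicE (D : set R) : measurable D ->
  measurable_fun [set: R] (fun x : R => (\1_D x)%:E : \bar R).
Proof. by move=> mD; apply/measurable_EFinP; exact: measurable_indic. Qed.

Variable f : R -> R.
Hypothesis f_density : is_density f.
Local Notation fE := (EFin \o f).

Let mf : measurable_fun [set: R] fE.
Proof. by apply/measurable_EFinP; case: f_density. Qed.

Let f0 x : 0 <= fE x.
Proof. by case: f_density => _ [f0 _]; rewrite lee_fin. Qed.

(** The case [t = 0] of the exponential identity. *)
Lemma integral_dens_sum n : \int[mu]_x dens_sum fE n x = 1.
Proof.
have := integral_dens_sum_expR _ mf f0 n 0.
have ex1 x : (expR (0 * x))%:E = 1 :> \bar R by rewrite mul0r expR0.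
under eq_integral do rewrite ex1 mule1.
under [X in _ = X ^+ _]eq_integral do rewrite ex1 mule1.
move=> ->; case: f_density => _ [_ ->]; elim: n => [|n IH].
  by rewrite expeS expe0 mule1.
by rewrite expeS IH mule1.
Qed.

(** The [fine] in [ptail] loses nothing, since the integral is at most the total mass 1. Later
    arguments can thus stay in the extended reals, with the event written as an indicator. *)
Lemma ptailE n gamma :
  (ptail f n.+1 gamma)%:E = \int[mu]_x (dens_sum fE n x * (\1_(`]gamma, +oo[) x)%:E).
Proof.
rewrite -integral_indicM /ptail fineK//.
have D0 := dens_sum_ge0 _ f0 n.
rewrite ge0_fin_numE ?integral_ge0//.
apply: (@le_lt_trans _ _ 1); last exact: ltry.
rewrite -(integral_dens_sum n); apply: ge0_subset_integral => //.
exact: measurable_dens_sum.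
Qed.

Lemma ptail_ge0 n gamma : (0 <= ptail f n.+1 gamma)%R.
Proof.
rewrite -lee_fin ptailE; apply: integral_ge0 => x _.
by rewrite mule_ge0// ?lee_fin// dens_sum_ge0.
Qed.

(** On [x > gamma] the indicator is at most [e^(t (x - gamma))], because [e^y >= 1 + y]; the moment
    generating function of the sum then factorizes. *)
Lemma ptail_chernoff n gamma (t M : R) : (0 <= t)%R ->
  \int[mu]_x (f x * expR (t * x))%:E <= M%:E ->
  (ptail f n.+1 gamma <= expR (- (t * gamma)) * M ^+ n.+1)%R.
Proof.
move=> t0 hM; rewrite -lee_fin ptailE.
have me : measurable_fun [set: R] (fun x : R => (expR (t * x))%:E).
  apply/measurable_EFinP; apply: (measurableT_comp (@measurable_expR R)).
  exact: (@mulrl_measurable R).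
have mD := measurable_dens_sum _ mf f0 n.
have D0 := dens_sum_ge0 _ f0 n.
apply: (@le_trans _ _ (\int[mu]_x ((expR (- (t * gamma)))%:E *
    (dens_sum fE n x * (expR (t * x))%:E)))).
  apply: ge0_le_integral => //.
  - by move=> x _; rewrite mule_ge0// lee_fin.
  - by apply: emeasurable_funM => //; exact: measurable_indicE.
  - by apply: measurable_funeM; exact: emeasurable_funM.
  - move=> x _; rewrite muleCA; apply: lee_pmul => //.
    rewrite -EFinM -expRD lee_fin indic_itvoy; case: ltP => [/ltW gx|_] /=.
      by rewrite (le_trans _ (expR_ge1Dx _))// lerDl addrC -mulrBr mulr_ge0// subr_ge0.
    by rewrite expR_ge0.
rewrite ge0_integralZl; last 4 first.
- exact: measurableT.
- by apply: emeasurable_funM.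
- by move=> x _; rewrite mule_ge0// lee_fin expR_ge0.
- by rewrite lee_fin expR_ge0.
rewrite (integral_dens_sum_expR _ mf f0) EFinM; apply: lee_pmul => //.
- by apply: expe_ge0; apply: integral_ge0 => x _; rewrite mule_ge0// lee_fin expR_ge0.
rewrite EFin_expe; elim: n.+1 => [|k IH]; first by rewrite !expe0.
rewrite !expeS; apply: lee_pmul => //.
- by apply: integral_ge0 => x _; rewrite mule_ge0// lee_fin expR_ge0.
- by apply: expe_ge0; apply: integral_ge0 => x _; rewrite mule_ge0// lee_fin expR_ge0.
Qed.

(** Induction on [n]: if the last summand exceeds [-b], which has probability at least [q], it is
    enough that the others sum to more than [gamma + b]. After [n] such steps a single summand has
    to exceed [gamma + n b]. *)
Lemma ptail_ge_one_big_jump n gamma (b q : R) : (0 <= q)%R ->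
  q%:E <= \int[mu]_(x in `](- b)%R, +oo[) (f x)%:E ->
  \int[mu]_(x in `](gamma + n%:R * b)%R, +oo[) (f x)%:E * (q ^+ n)%:E <=
  (ptail f n.+1 gamma)%:E.
Proof.
move=> q0 hq; rewrite ptailE.
elim: n gamma => [|n IH] gamma.
  by rewrite mul0r addr0 expr0 mule1 integral_indicM.
have D0 := dens_sum_ge0 _ f0 n.
have mD := measurable_dens_sum _ mf f0 n.
rewrite integral_dens_sumS//; last exact: measurable_indicE.
apply: (@le_trans _ _ (\int[mu]_y
    (dens_sum fE n y * (\1_(`](gamma + b)%R, +oo[) y)%:E * q%:E))).
  rewrite ge0_integralZr; last 4 first.
  - exact: measurableT.
  - by apply: emeasurable_funM => //; exact: measurable_indicE.
  - by move=> x _; rewrite mule_ge0// lee_fin.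
  - by rewrite lee_fin.
  rewrite exprSr EFinM muleA lee_wpmul2r ?lee_fin//.
  suff -> : (gamma + n.+1%:R * b = gamma + b + n%:R * b)%R by exact: IH.
  by rewrite -natr1; ring.
apply: ge0_le_integral => //.
- by move=> x _; rewrite !mule_ge0 ?lee_fin.
- apply: emeasurable_funM => //; apply: emeasurable_funM => //.
  exact: measurable_indicE.
- apply: emeasurable_funM => //.
  apply: (measurable_integral_shift fE (fun x => (\1_(`]gamma, +oo[) x)%:E)) => //.
  exact: measurable_indicE.
move=> y _; rewrite -muleA lee_pmul// ?mule_ge0 ?lee_fin//.
rewrite indic_itvoy; case: ltP => [yb|_]; last first.
  by rewrite /= mul0e; apply: integral_ge0 => z _; apply: mule_ge0 (f0 z) _.
rewrite /= mul1e; apply: (le_trans hq).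
rewrite integral_indicM; apply: ge0_le_integral => //.
- by move=> x _; apply: mule_ge0 (f0 x) _.
- by apply: emeasurable_funM => //; exact: measurable_indicE.
- apply: emeasurable_funM => //.
  apply: (measurableT_comp (measurable_indicE _ _)) => //.
  exact: measurable_funD.
move=> z _; apply: lee_pmul (f0 z) _ _ _; rewrite ?lee_fin//.
rewrite !indic_itvoy ler_nat; case: ltP => //= bz.
by have -> : (gamma < y + z)%R by lra.
Qed.

End Tails.

(** * Elementary inequalities for powers and the exponential *)

Section RealBounds.
Context {R : realType}.
Implicit Types x z w p : R.

Lemma ler_id_1Dpowr x p : 1 <= p -> 0 <= x -> x <= 1 + x `^ p.
Proof.
move=> p1 x0; have [x1|/ltW x1] := lerP x 1.
  by rewrite (le_trans x1)// lerDl powR_ge0.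
by rewrite (le_trans (le1r_powR x1 p1))// lerDr.
Qed.

Lemma ler_sqr_1Dpowr x p : 2 <= p -> 0 <= x -> x ^+ 2 <= 1 + x `^ p.
Proof.
move=> p2 x0; have [x1|/ltW x1] := lerP x 1.
  by rewrite (@le_trans _ _ 1) ?exprn_ile1// lerDl powR_ge0.
by rewrite -powR_mulrn// (le_trans (ler_powR x1 p2))// lerDr.
Qed.

Lemma powRD_le x y p : 0 <= p -> 0 <= x -> 0 <= y ->
  (x + y) `^ p <= 2 `^ p * (x `^ p + y `^ p).
Proof.
move=> p0 x0 y0; wlog xy : x y x0 y0 / x <= y.
  move=> H; have [xy|/ltW yx] := lerP x y; first exact: H.
  by rewrite addrC (addrC (x `^ p)); exact: H.
apply: (@le_trans _ _ ((2 * y) `^ p)).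
  by rewrite ge0_ler_powR ?nnegrE ?addr_ge0 ?mulr_ge0// mulr_natl mulr2n lerD2r.
by rewrite powRM// ler_wpM2l ?powR_ge0// lerDr powR_ge0.
Qed.

(** From [e^(-z) >= 1 - z] one gets [e^z <= 1 / (1 - z)], and [(1 + z + 2 z^2) (1 - z) - 1 = z^2 (1
    - 2 z)] is nonnegative for [z <= 1/2]. *)
Lemma expR_le_1Dx2 z : z <= 2^-1 -> expR z <= 1 + z + 2 * z ^+ 2.
Proof.
move=> z2; have z1 : 0 < 1 - z by lra.
apply: (@le_trans _ _ (1 - z)^-1).
  rewrite -[expR z]invrK -expRN lef_pV2 ?posrE ?expR_gt0//.
  exact: expR_ge1Dx.
rewrite -(ler_pM2r z1) mulVf ?gt_eqF// -subr_ge0.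
have -> : (1 + z + 2 * z ^+ 2) * (1 - z) - 1 = z ^+ 2 * (1 - 2 * z) by ring.
by rewrite mulr_ge0 ?sqr_ge0//; lra.
Qed.

(** Up to [z = 1/2] the quadratic bound suffices; beyond it [(2 |z|)^p >= 1], so the last term alone
    dominates [e^z]. The exponential factor thus multiplies only the moment of order [p]. *)
Lemma expR_le_moments z w p : 0 <= p -> z <= w ->
  expR z <= 1 + z + 2 * z ^+ 2 + (2 * `|z|) `^ p * expR w.
Proof.
move=> p0 zw; have [z2|z2] := lerP z 2^-1.
  by rewrite (le_trans (expR_le_1Dx2 _ z2))// lerDl mulr_ge0 ?powR_ge0 ?expR_ge0.
apply: (@le_trans _ _ (expR w)); first by rewrite ler_expR.
have z0 : 0 <= 1 + z + 2 * z ^+ 2 by rewrite !addr_ge0 ?mulr_ge0 ?sqr_ge0//; lra.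
rewrite -[leLHS]add0r lerD// ler_peMl ?expR_ge0//.
have h1 : 1 <= 2 * `|z| by rewrite gtr0_norm; lra.
by have := ler_powR h1 p0; rewrite powRr0.
Qed.

Lemma bernoulli_ineq (a : R) (n : nat) : 0 <= a <= 1 -> 1 - n%:R * a <= (1 - a) ^+ n.
Proof.
move=> /andP[a0 a1]; elim: n => [|n IH]; first by rewrite mul0r subr0 expr0.
rewrite exprS (@le_trans _ _ ((1 - a) * (1 - n%:R * a)))//; last first.
  by rewrite ler_wpM2l// subr_ge0.
rewrite -subr_ge0.
have -> : (1 - a) * (1 - n%:R * a) - (1 - n.+1%:R * a) = n%:R * a ^+ 2.
  by rewrite -natr1; ring.
by rewrite mulr_ge0 ?sqr_ge0.
Qed.

End RealBounds.

(** * Moments of order at most [p] and the distribution function *)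

Section Moments.
Context {R : realType}.
Local Notation mu := (@lebesgue_measure R).
Variables (f : R -> R) (p : R).
Hypotheses (f_density : is_density f) (p2 : 2 <= p).
Hypothesis fp : (\int[mu]_x (`|x| `^ p * f x)%:E < +oo)%E.

Let mf : measurable_fun [set: R] f. Proof. by case: f_density. Qed.

Let f0 x : 0 <= f x. Proof. by case: f_density => _ []. Qed.

Let p0 : 0 <= p. Proof. exact: le_trans p2. Qed.

Lemma integrable_density : mu.-integrable [set: R] (EFin \o f).
Proof.
apply/integrableP; split; first exact/measurable_EFinP.
under eq_integral do rewrite gee0_abs ?lee_fin//=.
by case: f_density => _ [_ ->]; exact: ltry.
Qed.

Lemma measurable_normpowR (a : R) : measurable_fun [set: R] (fun x : R => `|x - a| `^ p).
Proof.
apply: (measurableT_comp (measurable_powR _)).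
apply: (measurableT_comp (@normr_measurable R setT)).
exact: measurable_funB.
Qed.

(** Domination by [C (f + |x|^p f)]; the integrability facts for indicators, centered moments and
    truncated exponentials below reduce to this. *)
Lemma integrable_growth (h : R -> R) (C : R) :
  measurable_fun [set: R] h -> (forall x, `|h x| <= C * (1 + `|x| `^ p)) ->
  mu.-integrable [set: R] (EFin \o (fun x => h x * f x)).
Proof.
move=> mh hC.
have mp : measurable_fun [set: R] (fun x : R => `|x| `^ p).
  by apply: eq_measurable_fun (measurable_normpowR 0) => x _; rewrite subr0.
have ip : mu.-integrable [set: R] (EFin \o (fun x => `|x| `^ p * f x)).
  apply/integrableP; split.
    by apply/measurable_EFinP; exact: measurable_funM.
  under eq_integral do rewrite gee0_abs ?lee_fin ?mulr_ge0 ?powR_ge0//=.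
  exact: fp.
have id := integrableZl measurableT C (integrableD measurableT integrable_density ip).
apply: le_integrable id => //.
  by apply/measurable_EFinP; exact: measurable_funM.
move=> x _ /=; rewrite lee_fin normrM (ger0_norm (f0 x)).
rewrite (le_trans _ (ler_norm _))//.
have -> : C * (f x + `|x| `^ p * f x) = C * (1 + `|x| `^ p) * f x by ring.
by rewrite ler_wpM2r.
Qed.

Lemma integrable_indic_density (D : set R) : measurable D ->
  mu.-integrable [set: R] (EFin \o (fun x => \1_D x * f x)).
Proof.
move=> mD; apply: (@integrable_growth _ 1) => [|x].
  exact: measurable_indic.
rewrite mul1r indicE normr_nat (@le_trans _ _ 1)//; first by rewrite lern1 leq_b1.
by rewrite lerDl powR_ge0.
Qed.

Lemma integrable_center a : mu.-integrable [set: R] (EFin \o (fun x => (x - a) * f x)).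
Proof.
apply: (@integrable_growth _ (1 + `|a|)) => [|x].
  exact: measurable_funB.
rewrite (le_trans (ler_normB _ _))//.
have := @ler_id_1Dpowr R `|x| p (le_trans (ler1n _ 2) p2) (normr_ge0 _).
have := powR_ge0 `|x| p; have := normr_ge0 a; nra.
Qed.

Lemma integrable_center_sqr a :
  mu.-integrable [set: R] (EFin \o (fun x => (x - a) ^+ 2 * f x)).
Proof.
apply: (@integrable_growth _ (2 * (1 + a ^+ 2))) => [|x].
  by apply: measurable_funX; exact: measurable_funB.
rewrite ger0_norm ?sqr_ge0//.
(* The bound [(x - a)^2 <= 2 (x^2 + a^2)] is the nonnegativity of [(x + a)^2]. *)
have := @ler_sqr_1Dpowr R `|x| p p2 (normr_ge0 _); rewrite real_normK ?num_real//.
have := powR_ge0 `|x| p; have := sqr_ge0 (x + a); have := sqr_ge0 a; nra.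
Qed.

Lemma integrable_center_powR a :
  mu.-integrable [set: R] (EFin \o (fun x => `|x - a| `^ p * f x)).
Proof.
apply: (@integrable_growth _ (2 `^ p * (1 + `|a| `^ p))) => [|x].
  exact: measurable_normpowR.
rewrite ger0_norm ?powR_ge0// -mulrA.
apply: (@le_trans _ _ ((`|x| + `|a|) `^ p)).
  by rewrite ge0_ler_powR ?nnegrE ?addr_ge0// ler_normB.
rewrite (le_trans (powRD_le _ _ _ p0 (normr_ge0 _) (normr_ge0 _)))//.
rewrite ler_wpM2l ?powR_ge0//.
have := powR_ge0 `|x| p; have := powR_ge0 `|a| p; nra.
Qed.

Lemma Rintegral_density : \int[mu]_x f x = 1.
Proof. by rewrite /Rintegral; case: f_density => _ [_ ->]. Qed.

Lemma dens_cdfE u : dens_cdf f u = \int[mu]_x (\1_(`]-oo, u]) x * f x).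
Proof.
rewrite /dens_cdf integral_indicM /Rintegral; congr fine.
by apply: eq_integral => x _; rewrite -EFinM mulrC.
Qed.

Lemma Rintegral_itvoyE u : \int[mu]_x (\1_(`]u, +oo[) x * f x) = 1 - dens_cdf f u.
Proof.
rewrite dens_cdfE -Rintegral_density -RintegralB//; last 2 first.
- exact: integrable_density.
- exact: integrable_indic_density.
apply: eq_Rintegral => x _; rewrite -{2}(mul1r (f x)) -mulrBl; congr (_ * _).
rewrite indic_itvoy indicE.
suff -> : (x \in `]-oo, u]%classic) = ~~ (u < x) by case: (u < x); rewrite ?subr0 ?subrr.
by apply/idP/idP; rewrite inE/= in_itv/= leNgt.
Qed.

Lemma integral_itvoyE u :
  (\int[mu]_(x in `]u, +oo[) (f x)%:E = (1 - dens_cdf f u)%:E)%E.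
Proof.
rewrite -Rintegral_itvoyE /Rintegral fineK.
  rewrite integral_indicM; apply: eq_integral => x _.
  by rewrite -EFinM mulrC.
by apply: integrable_fin_num => //; exact: integrable_indic_density.
Qed.

Lemma dens_cdf_tail_le a b : a <= b -> 1 - dens_cdf f b <= 1 - dens_cdf f a.
Proof.
move=> ab; rewrite -!Rintegral_itvoyE; apply: le_Rintegral => //.
- exact: integrable_indic_density.
- exact: integrable_indic_density.
move=> x _; rewrite ler_wpM2r// !indic_itvoy ler_nat.
by case: (ltP b x) => // /(le_lt_trans ab) ->.
Qed.

Lemma dens_cdf_le1 a : dens_cdf f a <= 1.
Proof.
rewrite -subr_ge0 -Rintegral_itvoyE; apply: Rintegral_ge0 => x _.
by rewrite mulr_ge0.
Qed.

Lemma dens_cdf_le a b : a <= b -> dens_cdf f a <= dens_cdf f b.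
Proof. by move=> /dens_cdf_tail_le; lra. Qed.

Lemma integrable_powR : mu.-integrable [set: R] (EFin \o (fun x => `|x| `^ p * f x)).
Proof.
by apply: eq_integrable (integrable_center_powR 0) => // x _; rewrite /= subr0.
Qed.

(** Markov's inequality with [b^2] in place of [b^p]: since [b >= 1] and [p >= 2],
    [b^2 <= b^p <= |x|^p] on [x <= -b]. *)
Lemma dens_cdf_tail_markov b : 1 <= b ->
  1 - (\int[mu]_x (`|x| `^ p * f x)) / b ^+ 2 <= 1 - dens_cdf f (- b).
Proof.
move=> b1; have b0 : 0 < b by rewrite (lt_le_trans _ b1).
rewrite lerD2l lerN2 mulrC -(RintegralZl _ _ integrable_powR)//.
rewrite dens_cdfE; apply: le_Rintegral => //.
- exact: integrable_indic_density.
- exact: (integrableZl measurableT _ integrable_powR).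
move=> x _; rewrite mulrA ler_wpM2r// indicE.
have [|_] := boolP (x \in _); last by rewrite mulr_ge0 ?powR_ge0 ?invr_ge0 ?sqr_ge0.
rewrite inE/= in_itv/= => xb; rewrite mulrC ler_pdivlMr ?exprn_gt0// mul1r.
have bx : b <= `|x| by rewrite ler0_norm; lra.
rewrite -powR_mulrn ?(ltW b0)// (le_trans (ler_powR b1 p2))//.
by rewrite ge0_ler_powR ?nnegrE ?(ltW b0).
Qed.

End Moments.

(** * Moment generating function of the truncated law *)

Section TruncatedMgf.
Context {R : realType}.
Local Notation mu := (@lebesgue_measure R).
Variables (f : R -> R) (p m : R).
Hypotheses (f_density : is_density f) (p2 : 2 <= p).
Hypothesis fp : (\int[mu]_x (`|x| `^ p * f x)%:E < +oo)%E.
Hypothesis mE : m%:E = (\int[mu]_x (x * f x)%:E)%E.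

Let mf : measurable_fun [set: R] f. Proof. by case: f_density. Qed.

Let f0 x : 0 <= f x. Proof. by case: f_density => _ []. Qed.

Let p0 : 0 <= p. Proof. exact: le_trans p2. Qed.

Lemma Rintegral_centered : \int[mu]_x ((x - m) * f x) = 0.
Proof.
have ix : mu.-integrable [set: R] (EFin \o (fun x => x * f x)).
  apply: eq_integrable (integrable_center _ _ f_density p2 fp 0) => // x _.
  by rewrite /= subr0.
under eq_Rintegral do rewrite mulrBl.
have im := integrableZl measurableT m (integrable_density _ f_density).
rewrite (RintegralB measurableT ix im).
rewrite (RintegralZl _ measurableT (integrable_density _ f_density)).
by rewrite (Rintegral_density _ f_density) mulr1 /Rintegral -mE subrr.
Qed.

(** If [F(m) = 0], then [f] vanishes almost everywhere left of [m], so [(x - m) f] is almost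
    everywhere nonnegative with integral 0. Then [f] vanishes right of [m] as well, contradicting
    total mass 1. *)
Lemma dens_cdf_mean_gt0 : 0 < dens_cdf f m.
Proof.
have F0 : 0 <= dens_cdf f m.
  by rewrite dens_cdfE; apply: Rintegral_ge0 => x _; rewrite mulr_ge0.
rewrite lt_neqAle F0 andbT; apply/negP => /eqP F0'.
have i1 := integrable_indic_density _ _ f_density fp _ (measurable_itv `]-oo, m]).
have ae1 : ae_eq mu setT (fun x => (\1_(`]-oo, m]) x * f x)%:E) (cst 0%E).
  apply/ae_eq_integral_abs => //; first exact: measurable_int i1.
  under eq_integral do rewrite gee0_abs ?lee_fin ?mulr_ge0//.
  rewrite -[LHS]fineK; last exact: integrable_fin_num i1.
  by move: F0'; rewrite dens_cdfE /Rintegral => <-.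
have i2 := integrable_center _ _ f_density p2 fp m.
have m2 := measurable_int _ i2.
have ae2 : ae_eq mu setT (fun x => ((x - m) * f x)%:E) (cst 0%E).
  apply/ae_eq_integral_abs => //.
  transitivity (\int[mu]_x ((x - m) * f x)%:E)%E; last first.
    rewrite -[LHS]fineK; last exact: integrable_fin_num i2.
    by have := Rintegral_centered; rewrite /Rintegral => ->.
  apply: ae_eq_integral => //; first exact: measurableT_comp.
  apply: filterS ae1 => x /(_ I); rewrite indicE => h _.
  rewrite gee0_abs// lee_fin; have [xm|mx] := leP x m; last first.
    by rewrite mulr_ge0// subr_ge0 ltW.
  by move: h; rewrite mem_set ?mul1r//= ?in_itv//= => -[->]; rewrite mulr0.
have ae3 : ae_eq mu setT (EFin \o f) (cst 0%E).
  apply: filterS2 ae1 ae2 => x /(_ I) h1 /(_ I) h2 _ /=.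
  have [xm|mx] := leP x m.
    by move: h1; rewrite indicE mem_set ?mul1r//= in_itv.
  by case: h2 => /eqP; rewrite mulf_eq0 subr_eq0 gt_eqF//= => /eqP ->.
have : (\int[mu]_x (f x)%:E = 0)%E.
  rewrite -(integral0 mu setT); apply: ae_eq_integral => //.
  exact/measurable_EFinP.
by case: f_density => _ [_ ->] [] /eqP; rewrite oner_eq0.
Qed.

Lemma trunc_densityE u x :
  trunc_density f u x = (dens_cdf f u)^-1 * (\1_(`]-oo, u]) x * f x).
Proof.
have -> : \1_(`]-oo, u]) x = (x <= u)%R%:R :> R.
  rewrite indicE; congr (_ %:R); apply: congr1.
  by apply/idP/idP; rewrite inE/= in_itv.
rewrite /trunc_density; case: (x <= u); last by rewrite mul0r mulr0.
by rewrite mul1r mulrC.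
Qed.

Lemma is_density_trunc u : 0 < dens_cdf f u -> is_density (trunc_density f u).
Proof.
move=> Fu; have -> : trunc_density f u =
    fun x => (dens_cdf f u)^-1 * (\1_(`]-oo, u]) x * f x).
  by apply/funext => x; exact: trunc_densityE.
have iu := integrable_indic_density _ _ f_density fp _ (measurable_itv `]-oo, u]).
split; [|split].
- by apply: measurable_funM => //; exact: measurable_funM.
- by move=> x; rewrite !mulr_ge0// invr_ge0 ltW.
under eq_integral do rewrite EFinM.
rewrite integralZl//= -[X in (_ * X)%E]fineK; last exact: integrable_fin_num iu.
rewrite -[fine _]/(\int[mu]_x (\1_(`]-oo, u]) x * f x)) -dens_cdfE -EFinM.
by rewrite mulVf// gt_eqF.
Qed.

Local Notation V := (\int[mu]_x ((x - m) ^+ 2 * f x)).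
Local Notation W := (\int[mu]_x (`|x - m| `^ p * f x)).

Lemma integrable_indic_expR u t : 0 <= t -> mu.-integrable [set: R]
  (EFin \o (fun x => \1_(`]-oo, u]) x * expR (t * (x - m)) * f x)).
Proof.
move=> t0.
apply: (integrable_growth _ p f_density fp _ (expR (t * (u - m)))) => [|x].
  apply: measurable_funM; first exact: measurable_indic.
  apply: (measurableT_comp (@measurable_expR R)); apply: measurable_funM => //.
  exact: measurable_funB.
rewrite ger0_norm ?mulr_ge0 ?expR_ge0// indicE.
apply: (@le_trans _ _ (expR (t * (u - m)))); last first.
  by rewrite ler_peMr ?expR_ge0// lerDl powR_ge0.
have [|_] := boolP (x \in _); last by rewrite mul0r expR_ge0.
rewrite inE/= in_itv/= mul1r ler_expR => xu.
by rewrite ler_wpM2l// lerD2r.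
Qed.

(** Integrates [expR_le_moments] with [z = t (x - m)] and [w = t (u - m)]. The indicator stays on
    the constant term only; the other terms are extended to the whole line, where the linear one
    integrates to 0 because [m] is the mean. *)
Lemma indic_mgf_le u t : 0 <= t -> m <= u ->
  \int[mu]_x (\1_(`]-oo, u]) x * expR (t * (x - m)) * f x) <=
  dens_cdf f u + 2 * t ^+ 2 * V + (2 * t) `^ p * expR (t * (u - m)) * W.
Proof.
move=> t0 mu_.
have i0 := integrable_indic_density _ _ f_density fp _ (measurable_itv `]-oo, u]).
have i1 := integrable_center _ _ f_density p2 fp m.
have i2 := integrable_center_sqr _ _ f_density p2 fp m.
have i3 := integrable_center_powR _ _ f_density p2 fp m.
have j1 := integrableZl measurableT t i1.
have j2 := integrableZl measurableT (2 * t ^+ 2) i2.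
have j3 := integrableZl measurableT ((2 * t) `^ p * expR (t * (u - m))) i3.
have j01 := integrableD measurableT i0 j1.
have j012 := integrableD measurableT j01 j2.
have j := integrableD measurableT j012 j3.
apply: (@le_trans _ _ (\int[mu]_x (\1_(`]-oo, u]) x * f x + t * ((x - m) * f x)
   + 2 * t ^+ 2 * ((x - m) ^+ 2 * f x)
   + (2 * t) `^ p * expR (t * (u - m)) * (`|x - m| `^ p * f x)))).
  (* For [x > u >= m] the left side vanishes and [t * (x - m) >= 0]. *)
  apply: le_Rintegral => //; first exact: integrable_indic_expR.
  move=> x _; rewrite !mulrA -!mulrDl ler_wpM2r// indicE.
  have [|] := boolP (x \in _).
    rewrite inE/= in_itv/= mul1r => xu.
    have /(expR_le_moments _ _ p p0) : t * (x - m) <= t * (u - m).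
      by rewrite ler_wpM2l// lerD2r.
    rewrite normrM (ger0_norm t0) (mulrA 2 t `|_|) (@powRM R (2 * t)) ?mulr_ge0// => h.
    by apply: (le_trans h); rewrite le_eqVlt; apply/orP; left; apply/eqP => /=; ring.
  rewrite notin_setE/= in_itv/= => /negP; rewrite -ltNge => ux.
  have xm : 0 <= x - m by rewrite subr_ge0 ltW// (le_lt_trans mu_).
  by rewrite mul0r add0r !addr_ge0 ?mulr_ge0 ?powR_ge0 ?expR_ge0.
rewrite le_eqVlt; apply/orP; left; apply/eqP.
etransitivity; first by apply: RintegralD; [exact: measurableT|exact: j012|exact: j3].
congr (_ + _); last exact: (RintegralZl _ measurableT i3).
etransitivity; first by apply: RintegralD; [exact: measurableT|exact: j01|exact: j2].
congr (_ + _); last exact: (RintegralZl _ measurableT i2).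
etransitivity; first by apply: RintegralD; [exact: measurableT|exact: i0|exact: j1].
rewrite -dens_cdfE -[RHS]addr0; congr (_ + _).
by rewrite (RintegralZl _ measurableT i1) Rintegral_centered mulr0.
Qed.

(** For [u >= m] the normalization [F(u)] is at least [F(m) > 0], which makes [K] independent of [u]
    and [t]. For [u < m] the truncated variable stays below [m], so its centered moment generating
    function is at most 1. *)
Lemma trunc_mgf_le : exists2 K : R, 0 <= K & forall u t : R,
  0 < dens_cdf f u -> 0 < t ->
  (\int[mu]_x (trunc_density f u x * expR (t * x))%:E <=
   (expR (t * m + K * t ^+ 2 *
      (1 + t `^ (p - 2) * expR (t * Num.max (u - m) 0))))%:E)%E.
Proof.
have c0 := dens_cdf_mean_gt0; set c := dens_cdf f m in c0.
have V0 : 0 <= V by apply: Rintegral_ge0 => x _; rewrite mulr_ge0 ?sqr_ge0.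
have W0 : 0 <= W by apply: Rintegral_ge0 => x _; rewrite mulr_ge0 ?powR_ge0.
have [K K0 KE] : exists2 K, 0 <= K & c * K = 2 * V + 2 `^ p * W.
  exists ((2 * V + 2 `^ p * W) / c); last by field; rewrite gt_eqF.
  by rewrite divr_ge0 ?(ltW c0)// addr_ge0 ?mulr_ge0 ?powR_ge0.
exists K => // u t Fu t0.
have ie := integrable_indic_expR u t (ltW t0).
have -> : (\int[mu]_x (trunc_density f u x * expR (t * x))%:E =
  (expR (t * m) / dens_cdf f u *
     \int[mu]_x (\1_(`]-oo, u]) x * expR (t * (x - m)) * f x))%:E)%E.
  rewrite -(RintegralZl _ measurableT ie) /Rintegral fineK; last first.
    exact: integrable_fin_num (integrableZl measurableT _ ie).
  apply: eq_integral => x _; rewrite trunc_densityE.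
  by congr EFin; rewrite mulrBr expRD expRN; field; rewrite !gt_eqF ?expR_gt0.
rewrite lee_fin expRD -mulrA ler_wpM2l ?expR_ge0// mulrC ler_pdivrMr//.
have [um|mu_] := ltP u m.
  rewrite max_r ?subr_le0 ?(ltW um)//.
  apply: (@le_trans _ _ (dens_cdf f u)).
    rewrite dens_cdfE; apply: le_Rintegral => //.
      exact: integrable_indic_density f_density fp _ _.
    move=> x _; rewrite ler_wpM2r// indicE.
    have [|_] := boolP (x \in _); last by rewrite mul0r.
    rewrite inE/= in_itv/= mul1r expR_le1 => xu.
    by rewrite mulr_ge0_le0 ?(ltW t0)// subr_le0 (le_trans xu)// ltW.
  rewrite ler_peMl ?(ltW Fu)// (le_trans _ (expR_ge1Dx _))// lerDl.
  by rewrite !mulr_ge0 ?addr_ge0 ?mulr_ge0 ?powR_ge0 ?expR_ge0 ?(ltW t0).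
rewrite max_l ?subr_ge0//.
apply: (le_trans (indic_mgf_le _ _ (ltW t0) mu_)).
set e := expR (t * (u - m)); set q := t `^ (p - 2).
have e0 : 0 <= e by exact: expR_ge0.
have q0 : 0 <= q by exact: powR_ge0.
have -> : (2 * t) `^ p = 2 `^ p * (t ^+ 2 * q).
  rewrite powRM ?(ltW t0)//; congr (_ * _).
  rewrite -powR_mulrn ?(ltW t0)// -powRD ?(gt_eqF t0) ?implybT//.
  by congr powR; ring.
apply: (@le_trans _ _ (dens_cdf f u + c * (K * t ^+ 2 * (1 + q * e)))).
  (* These are the cross terms left over when [(2 V + 2^p W) (1 + q e)] is expanded. *)
  have : 0 <= t ^+ 2 * (2 `^ p * W + 2 * V * (q * e)).
    by rewrite mulr_ge0 ?sqr_ge0// addr_ge0 ?mulr_ge0 ?powR_ge0.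
  move=> h; rewrite -subr_ge0 !mulrA KE; apply: (le_trans h).
  by rewrite le_eqVlt; apply/orP; left; apply/eqP; ring.
set Z := K * t ^+ 2 * _.
have Z0 : 0 <= Z.
  by rewrite /Z !mulr_ge0 ?addr_ge0 ?mulr_ge0 ?(ltW t0).
apply: (@le_trans _ _ ((1 + Z) * dens_cdf f u)).
  rewrite mulrDl mul1r lerD2l mulrC ler_wpM2l//.
  exact: dens_cdf_le f_density fp _ _ mu_.
by rewrite ler_wpM2r ?(ltW Fu)// expR_ge1Dx.
Qed.

End TruncatedMgf.

(** * Nonasymptotic bounds on the two tail probabilities *)

Section PtailBounds.
Context {R : realType}.
Local Notation mu := (@lebesgue_measure R).
Variables (f : R -> R) (p : R).
Hypotheses (f_density : is_density f) (p2 : 2 <= p).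
Hypothesis fp : (\int[mu]_x (`|x| `^ p * f x)%:E < +oo)%E.

(** Chernoff's bound applied to [trunc_mgf_le]. The constant [K] is fixed before [n], [gamma], [u]
    and [t], so [t] may later depend on [n]. *)
Lemma ptail_trunc_upper m : m%:E = (\int[mu]_x (x * f x)%:E)%E ->
  exists2 K : R, 0 <= K & forall n gamma u t,
  0 < dens_cdf f u -> 0 < t ->
  ptail (trunc_density f u) n.+1 gamma <=
  expR (- (t * (gamma - n.+1%:R * m)) + n.+1%:R * (K * t ^+ 2 *
      (1 + t `^ (p - 2) * expR (t * Num.max (u - m) 0)))).
Proof.
move=> mE; have [K K0 HK] := trunc_mgf_le _ _ _ f_density p2 fp mE.
exists K => // n gamma u t Fu t0; set D := K * t ^+ 2 * _.
have fu := is_density_trunc _ _ f_density fp _ Fu.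
apply: (le_trans (ptail_chernoff _ fu _ _ _ _ (ltW t0) (HK _ _ Fu t0))).
rewrite -expRM_natl -expRD ler_expR -/D le_eqVlt; apply/orP; left; apply/eqP.
by ring.
Qed.

(* One jump above [gamma + (n+1)^2] wins provided the other [n] summands stay
   above [-(n+1)], which fails with probability at most [E|X|^p / (n+1)]. *)
Lemma ptail_lower : exists N : nat, forall n gamma y,
  (N <= n)%N -> gamma + n.+1%:R ^+ 2 <= y ->
  2^-1 * (1 - dens_cdf f y) <= ptail f n.+1 gamma.
Proof.
set M := \int[mu]_x (`|x| `^ p * f x).
have M0 : 0 <= M.
  by apply: Rintegral_ge0 => x _; rewrite mulr_ge0 ?powR_ge0//; case: f_density => _ [].
exists (Num.bound (2 * M)) => n gamma y Nn ny.
have nM : 2 * M <= n.+1%:R.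
  rewrite (le_trans (ltW (archi_boundP _)))// ?mulr_ge0// ler_nat.
  exact: leqW.
have n1 : 1 <= n.+1%:R :> R by rewrite ler1n.
have n0 : 0 < n.+1%:R :> R by rewrite ltr0n.
(* A summand is at most [-(n+1)] with probability at most [a]; Bernoulli's inequality then gives
   [(1 - a)^n >= 1 - n a >= 1/2], the choice of threshold ensuring [2 M <= n + 1]. *)
set a := M / n.+1%:R ^+ 2.
have na : n.+1%:R * a <= 2^-1.
  have -> : n.+1%:R * a = M / n.+1%:R by rewrite /a; field; rewrite gt_eqF.
  by rewrite ler_pdivrMr//; lra.
have a0 : 0 <= a by rewrite divr_ge0 ?sqr_ge0.
have a1 : a <= 1.
  apply: (@le_trans _ _ (n.+1%:R * a)); first by rewrite ler_peMl.
  by rewrite (le_trans na)// invf_le1// ler1n.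
have q0 : 0 <= 1 - a by rewrite subr_ge0.
have hq : ((1 - a)%:E <= \int[mu]_(x in `](- n.+1%:R)%R, +oo[) (f x)%:E)%E.
  rewrite (integral_itvoyE _ _ f_density fp) lee_fin.
  exact: dens_cdf_tail_markov f_density p2 fp _ n1.
have := ptail_ge_one_big_jump _ f_density n gamma _ _ q0 hq.
rewrite (integral_itvoyE _ _ f_density fp) -EFinM lee_fin; apply: le_trans.
rewrite mulrC; apply: ler_pM.
- by rewrite subr_ge0 (dens_cdf_le1 _ _ f_density fp).
- by rewrite invr_ge0.
- apply: (dens_cdf_tail_le _ _ f_density fp); apply: le_trans ny.
  by rewrite lerD2l expr2 ler_wpM2r ?ler_nat// ltW.
- apply: le_trans (bernoulli_ineq a n _); last by rewrite a0 a1.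
  have : n%:R * a <= n.+1%:R * a by rewrite ler_wpM2r// ler_nat.
  lra.
Qed.

End PtailBounds.

(** * Polynomial lower bound for a regularly varying tail *)

Section SlowVariation.
Context {R : realType}.

(** Halve [y] until it falls in [[y0, 2 y0]], where [G y >= G (2 y0)] by monotonicity and
    [(y0 / y)^b <= 1]. Each doubling costs [2^(-b)], exactly what [y^(-b)] loses. *)
Lemma doubling_lower_bound (G : R -> R) (b y0 : R) : 0 < y0 -> 0 <= b ->
  (forall x y, x <= y -> G y <= G x) ->
  (forall y, y0 <= y -> 2 `^ (- b) * G y <= G (2 * y)) -> 0 < G (2 * y0) ->
  exists2 c, 0 < c & forall y, y0 <= y -> c * y `^ (- b) <= G y.
Proof.
move=> y00 b0 Gle Gdbl G0; exists (G (2 * y0) * y0 `^ b).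
  by rewrite mulr_gt0 ?powR_gt0.
suff H k y : y0 <= y -> y <= 2 ^+ k * y0 -> G (2 * y0) * y0 `^ b * y `^ (- b) <= G y.
  (* Any integer [k] above [y / y0] allows enough halvings, since [k < 2^k]. *)
  move=> y yy0; apply: (H (Num.bound (y / y0))) => //.
  rewrite -ler_pdivrMr// ltW// (lt_le_trans (archi_boundP _))//.
    by rewrite divr_ge0 ?(ltW y00)// (le_trans _ yy0)// ltW.
  by rewrite -natrX ler_nat ltnW// ltn_expl.
elim: k y => [|k IH] y yy0; last rewrite exprS; move=> yk.
  have y1 : y <= 2 * y0 by move: yk; rewrite expr0; lra.
  apply: le_trans (Gle _ _ y1); rewrite -mulrA ler_piMr ?(ltW G0)//.
  rewrite powRN ler_pdivrMr ?powR_gt0 ?(lt_le_trans y00)// mul1r.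
  by rewrite ge0_ler_powR ?nnegrE ?(ltW y00)// (le_trans _ yy0)// ltW.
have [y1|y1] := leP y (2 * y0).
  apply: le_trans (Gle _ _ y1); rewrite -mulrA ler_piMr ?(ltW G0)//.
  rewrite powRN ler_pdivrMr ?powR_gt0 ?(lt_le_trans y00)// mul1r.
  by rewrite ge0_ler_powR ?nnegrE ?(ltW y00)// (le_trans _ yy0)// ltW.
have z0 : y0 <= y / 2 by lra.
have zk : y / 2 <= 2 ^+ k * y0 by move: yk; set X := 2 ^+ k; lra.
have := Gdbl _ z0; have -> : 2 * (y / 2) = y by field.
apply: le_trans; have := IH _ z0 zk.
rewrite -(ler_pM2l (powR_gt0 (- b) (ltr0n R 2))); apply: le_trans.
rewrite mulrCA ler_wpM2l ?mulr_ge0 ?powR_ge0 ?(ltW G0)//.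
by rewrite -powRM ?divr_ge0//; [have -> : 2 * (y / 2) = y by field|lra].
Qed.

(** Eventually [L (2 y) / L y > 1/2], so doubling [y] costs [G] at most a factor [2^(-alpha) / 2],
    whence the exponent [alpha + 1]. *)
Lemma tail_poly_lower (G L : R -> R) (alpha : R) : 0 <= alpha ->
  (forall x y, x <= y -> G y <= G x) ->
  slowly_varying L -> (forall x, 0 < x -> G x = L x * x `^ (- alpha)) ->
  exists c y0 : R, [/\ 0 < c, 0 < y0 &
    forall y, y0 <= y -> c * y `^ (- (alpha + 1)) <= G y].
Proof.
move=> alpha0 Gle [_ [[A LA] Lcvg]] GL.
have L2 := Lcvg 2 (ltr0n R 2).
have : \forall x \near +oo, 2^-1 < L (2 * x) / L x.
  by apply: (cvgr_gt _ L2); rewrite invf_lt1// ltr1n.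
case=> [B [_ LB]].
pose y0 := Num.max 1 (Num.max (A + 1) (B + 1)).
have y1 : 1 <= y0 by rewrite le_max lexx.
have yA : A < y0 by rewrite (@lt_le_trans _ _ (A + 1)) ?ltrDl// !le_max lexx ?orbT.
have yB : B < y0 by rewrite (@lt_le_trans _ _ (B + 1)) ?ltrDl// !le_max lexx ?orbT.
have y00 : 0 < y0 by rewrite (lt_le_trans _ y1).
have [||c c0 Hc] := doubling_lower_bound G (alpha + 1) y0 y00 (addr_ge0 alpha0 ler01) Gle.
- move=> y yy0; have Ly : 0 < L y by apply: LA; rewrite (lt_le_trans yA).
  have y_gt0 : 0 < y by rewrite (lt_le_trans y00).
  have := LB y (lt_le_trans yB yy0); rewrite /= ltr_pdivlMr// => /ltW h.
  rewrite !GL ?mulr_gt0// powRM ?(ltW y_gt0)// opprD powRD; last first.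
    by rewrite pnatr_eq0 implybT.
  rewrite powR_inv1//.
  have := powR_ge0 2 (- alpha); have := powR_ge0 y (- alpha).
  set a := 2 `^ _; set d := y `^ _ => d0 a0.
  have -> : a * 2^-1 * (L y * d) = (2^-1 * L y) * (a * d) by ring.
  by rewrite ler_wpM2r// mulr_ge0.
- have y2 : A < 2 * y0 by lra.
  by rewrite GL ?mulr_gt0// ?LA// powR_gt0// mulr_gt0.
by exists c, y0.
Qed.

End SlowVariation.

(** * Optimization of the Chernoff exponent *)

(* Here [n] is the sample size, [x = gamma - n m], [w = x / sqrt (n ln n)] and
   [v = (u - m)^+]. *)
Lemma chernoff_exponent (R : realType) (A C K delta n x v w : R) :
  0 < A -> 0 <= C -> 0 <= K -> 0 < delta -> 0 < n ->
  1 <= w -> 4 * K * A ^+ 2 <= w -> x = w * Num.sqrt (n * ln n) ->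
  v <= C * (x / Num.sqrt (ln n)) ->
  1 <= ln n -> 32 * A <= ln n -> 2 * A * C <= delta * Num.sqrt (ln n) ->
  let t := A * ln x / x in
  [/\ 0 < x, ln n <= 2 * ln x, 0 < t &
   - (t * x) + n * (K * t ^+ 2 * (1 + t `^ delta * expR (t * v))) <=
   - ((A - 1) * ln x)].
Proof.
move=> A0 C0 K0 d0 n0 w1 Kw xE vx; set g := ln n => g1 gA gC t.
have g0 : 0 < g by rewrite (lt_le_trans _ g1).
have w0 : 0 < w by rewrite (lt_le_trans _ w1).
have x0 : 0 < x by rewrite xE mulr_gt0// sqrtr_gt0 mulr_gt0.
have x2 : x ^+ 2 = w ^+ 2 * (n * g).
  by rewrite xE exprMn sqr_sqrtr// mulr_ge0 ?ltW.
pose l := ln x.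
have l2 : ln (x ^+ 2) = 2 * l by rewrite lnXn// mulr_natl.
have gl : g <= 2 * l.
  rewrite -l2 /g ler_ln ?posrE ?exprn_gt0// x2 mulrCA ler_peMr ?(ltW n0)//.
  by rewrite mulr_ege1// exprn_ege1.
(* Take logarithms in [x^2 = w^2 n g] and use [ln w < w] and [ln g < g]. *)
have lw : l <= w + g.
  have : 2 * l = 2 * ln w + (g + ln g).
    rewrite -l2 x2 lnM ?posrE ?exprn_gt0 ?mulr_gt0// lnXn// mulr_natl.
    by rewrite lnM ?posrE.
  by have := ln_sublinear w0; have := ln_sublinear g0; lra.
have l0 : 0 < l by lra.
have t0 : 0 < t by rewrite divr_gt0 ?mulr_gt0.
split => //; rewrite -/l.
have tx : t * x = A * l by rewrite /t -/l; field; rewrite gt_eqF.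
(* Here [n t^2 = A^2 l^2 / (w^2 g)]. As [w, g >= 1], [l <= w + g <= 2 w g], so the left side is at
   most [(4 K A^2 / w) l]. *)
have H1 : n * (2 * (K * t ^+ 2)) <= l.
  have -> : n * (2 * (K * t ^+ 2)) = (2 * K * A ^+ 2 * (n * l)) / x ^+ 2 * l.
    by rewrite /t -/l; field; rewrite gt_eqF.
  rewrite ler_piMl ?(ltW l0)// ler_pdivrMr ?exprn_gt0// mul1r x2.
  have -> : 2 * K * A ^+ 2 * (n * l) = n * (2 * K * A ^+ 2 * l) by ring.
  rewrite (mulrCA (w ^+ 2)) ler_wpM2l ?(ltW n0)//.
  have KA : 0 <= K * A ^+ 2 by rewrite mulr_ge0 ?sqr_ge0.
  have l2wg : l <= 2 * (w * g) by nra.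
  apply: (@le_trans _ _ (2 * K * A ^+ 2 * (2 * (w * g)))).
    by rewrite ler_wpM2l// -mulrA mulr_ge0.
  have -> : 2 * K * A ^+ 2 * (2 * (w * g)) = 4 * K * A ^+ 2 * (w * g) by ring.
  have -> : w ^+ 2 * g = w * (w * g) by ring.
  by rewrite ler_wpM2r// mulr_ge0 ?ltW.
have xl : x = expR l by rewrite lnK.
(* Since [t = A l e^(-l)], this asks for [A l <= e^(l/2)]. It follows from [e^(l/2) >= (l/4)^2] and
   [l >= 16 A], the latter from [32 A <= g <= 2 l]. *)
have tl : t <= expR (- (l / 2)).
  rewrite /t -/l {1}xl -expRN.
  have -> : - l = - (l / 2) + - (l / 2) by field.
  rewrite expRD mulrA ler_piMl ?expR_ge0// expRN ler_pdivrMr ?expR_gt0// mul1r.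
  have -> : l / 2 = l / 4 + l / 4 by field.
  rewrite expRD; have := expR_ge1Dx (l / 4); set e := expR _ => h.
  have : l / 4 * (l / 4) <= e * e by rewrite ler_pM//; lra.
  by apply: le_trans; nra.
have tv : t * v <= delta * (l / 2).
  apply: (@le_trans _ _ (t * (C * (x / Num.sqrt g)))); first by rewrite ler_wpM2l// ltW.
  have sg : 0 < Num.sqrt g by rewrite sqrtr_gt0.
  have -> : t * (C * (x / Num.sqrt g)) = A * C * l / Num.sqrt g.
    by rewrite /t -/l; field; rewrite !gt_eqF.
  rewrite ler_pdivrMr//.
  have : 2 * A * C * l <= delta * Num.sqrt g * l by rewrite ler_wpM2r// ltW.
  lra.
(* The decay [e^(-delta l / 2)] of [t^delta] cancels the growth allowed by [tv]. *)
have H2 : t `^ delta * expR (t * v) <= 1.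
  have e1 : t `^ delta <= expR (- (l / 2) * delta).
    by rewrite expRM ge0_ler_powR ?nnegrE ?expR_ge0 ?(ltW t0) ?(ltW d0).
  apply: (@le_trans _ _ (expR (- (l / 2) * delta) * expR (delta * (l / 2)))).
    by rewrite ler_pM ?powR_ge0 ?expR_ge0// ler_expR.
  by rewrite -expRD mulNr mulrC addrC subrr expR0.
have : n * (K * t ^+ 2 * (1 + t `^ delta * expR (t * v))) <= n * (2 * (K * t ^+ 2)).
  have Kt : 0 <= K * t ^+ 2 by apply: mulr_ge0 => //; exact: sqr_ge0.
  by rewrite ler_wpM2l ?(ltW n0)// (mulrC 2) ler_wpM2l//; lra.
move=> h; rewrite tx; have -> : - ((A - 1) * l) = - (A * l) + l by ring.
by rewrite lerD2l (le_trans h).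
Qed.

(** * Choice of thresholds and comparison of the two tail probabilities *)

Lemma nat_ln_ge (R : realType) (B : R) :
  exists N : nat, forall n, (N <= n)%N -> B <= ln (n%:R : R).
Proof.
exists (Num.bound (expR B)) => n Nn.
have Bn : expR B <= n%:R.
  by rewrite (le_trans (ltW (archi_boundP (expR_ge0 _))))// ler_nat.
by rewrite -[B]expRK ler_ln ?posrE ?expR_gt0// (lt_le_trans (expR_gt0 B)).
Qed.

Theorem theorem1 (R : realType) (f : R -> R) (L : R -> R) (alpha delta m : R)
  (gamma u : nat -> R) :
  is_density f ->
  slowly_varying L -> 2 < alpha ->
  (forall x : R, 0 < x -> 1 - dens_cdf f x = L x * powR x (- alpha)) ->
  0 < delta ->
  (\int[@lebesgue_measure R]_x (powR `|x| (2 + delta) * f x)%:E < +oo)%E ->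
  m%:E = (\int[@lebesgue_measure R]_x (x * f x)%:E)%E ->
  (fun n : nat => (gamma n - n%:R * m) / Num.sqrt (n%:R * ln (n%:R : R)))
     @ \oo --> +oo ->
  (exists C : R, exists N : nat, forall n : nat, (N <= n)%N ->
     u n <= m + C * ((gamma n - n%:R * m) / Num.sqrt (ln (n%:R : R)))) ->
  (forall n : nat, 0 < dens_cdf f (u n)) ->
  exists eps : nat -> R, eps @ \oo --> (0 : R) /\
    exists N : nat, forall n : nat, (N <= n)%N ->
      ptail (trunc_density f (u n)) n (gamma n) - ptail f n (gamma n)
      = - ptail f n (gamma n) * (1 + eps n).
Proof.
move=> f_density Lsv alpha2 tailE delta0 fp mE wcvg [C [NC uC]] Fu.
have p2 : 2 <= 2 + delta by rewrite lerDl ltW.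
have [K K0 HK] := ptail_trunc_upper _ _ f_density p2 fp _ mE.
have [N1 HN1] := ptail_lower _ _ f_density p2 fp.
have alpha0 : 0 <= alpha by lra.
have [c [y0 [c0 y00 Hc]]] := tail_poly_lower (fun x => 1 - dens_cdf f x) L
  alpha alpha0 (dens_cdf_tail_le _ _ f_density fp) Lsv tailE.
(* The tail of [F] at level [x^5] is at least [c x^(-5 b)], while the truncated bound is
   [x^(-(A - 1)) = x^(-5 b - 2)]. Of the two spare powers of [x], one pays for [w], the other for
   the constant [2 / c]. *)
pose b := alpha + 1; pose A := 5 * b + 3.
have b0 : 0 < b by rewrite /b; lra.
have A0 : 0 < A by rewrite /A; lra.
(* A nonnegative constant also bounds the positive part of [u n - m]. *)
pose C' := Num.max C 0.
have C'0 : 0 <= C' by rewrite le_max lexx orbT.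
pose w n := (gamma n - n%:R * m) / Num.sqrt (n%:R * ln (n%:R : R)).
have Hw B : exists N : nat, forall n, (N <= n)%N -> B <= w n.
  have : \forall n \near \oo, B <= w n by move: B; apply/cvgryPge.
  by case=> N _ H; exists N => n Nn; exact: H.
(* The last threshold is squared because [sqrt (ln n)] has to reach [2 A C' / delta]. *)
have [N2 HN2] := nat_ln_ge _ (Num.max 1 (Num.max (32 * A) ((2 * A * C' / delta) ^+ 2))).
have [N3 HN3] := Hw (Num.max 1 (Num.max (4 * K * A ^+ 2)
  (Num.max (2 + `|m|) (Num.max y0 (2 / c))))).
(* A quantitative form of the conclusion: the ratio of the two tails is at most [1 / w n], which
   tends to 0. *)
have key : exists N : nat, forall n, (N <= n)%N ->
  0 < ptail f n (gamma n) /\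
  `|ptail (trunc_density f (u n)) n (gamma n)| <= ptail f n (gamma n) / w n.
  (* The successor excludes [n = 0] and accounts for [ptail_lower] being indexed by [k = n - 1]. *)
  exists (N1.+1 + N2 + N3 + NC)%N => -[|k] //= kN.
  set n := k.+1.
  have [kN1 nN2 nN3 nNC] : [/\ (N1 <= k)%N, (N2 <= n)%N, (N3 <= n)%N & (NC <= n)%N].
    by rewrite /n; clear -kN; split; lia.
  have := HN2 n nN2; rewrite !ge_max => /and3P[g1 gA gC].
  have := HN3 n nN3; rewrite !ge_max => /and5P[w1 wK wm wy wc].
  have n0 : 0 < n%:R :> R by rewrite ltr0n.
  have g0 : 0 < ln (n%:R : R) by rewrite (lt_le_trans _ g1).
  set x := gamma n - n%:R * m.
  have s0 : 0 < Num.sqrt (n%:R * ln (n%:R : R)) by rewrite sqrtr_gt0 mulr_gt0.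
  have xE : x = w n * Num.sqrt (n%:R * ln (n%:R : R)).
    by rewrite /w mulfVK// gt_eqF.
  have w0 : 0 < w n by rewrite (lt_le_trans _ w1).
  have x0 : 0 < x by rewrite xE mulr_gt0.
  have sg0 : 0 < Num.sqrt (ln (n%:R : R)) by rewrite sqrtr_gt0.
  have vx : Num.max (u n - m) 0 <= C' * (x / Num.sqrt (ln (n%:R : R))).
    have xs : 0 <= x / Num.sqrt (ln (n%:R : R)) by rewrite divr_ge0 ?ltW.
    rewrite ge_max mulr_ge0// andbT.
    apply: (@le_trans _ _ (C * (x / Num.sqrt (ln (n%:R : R))))).
      by rewrite lerBlDl; exact: (uC n nNC).
    by rewrite ler_wpM2r// le_max lexx.
  have gC' : 2 * A * C' <= delta * Num.sqrt (ln (n%:R : R)).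
    rewrite -ler_pdivrMl// mulrC -(ler_pXn2r (_ : 0 < 2)%N) ?nnegrE//.
    - by rewrite sqr_sqrtr// ltW.
    - by rewrite divr_ge0 ?mulr_ge0 ?(ltW A0) ?(ltW delta0).
  have [_ gl t0 Hexp] := chernoff_exponent _ A C' K delta n%:R x _ (w n)
    A0 C'0 K0 delta0 n0 w1 wK xE vx g1 gA gC'.
  have xw : w n <= x.
    rewrite xE ler_peMr ?(ltW w0)// -[leLHS]sqrtr1 ler_wsqrtr// mulr_ege1//.
    by rewrite ler1n.
  have x1 : 1 <= x by rewrite (le_trans w1).
  have nx : n%:R <= x ^+ 2 :> R.
    rewrite xE exprMn sqr_sqrtr ?mulr_ge0 ?(ltW g0)//.
    by rewrite mulrCA ler_peMr ?(ltW n0)// mulr_ege1// exprn_ege1.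
  have y0x : y0 <= x ^+ 5.
    by rewrite (le_trans (le_trans wy xw))// -[leLHS]expr1 ler_weXn2l.
  (* From [n <= x^2], the sum [x + n m + n^2] is at most [x^4 (2 + |m|)], and
     [2 + |m| <= w n <= x]. *)
  have gx : gamma n + n%:R ^+ 2 <= x ^+ 5.
    have gE : gamma n = x + n%:R * m by rewrite /x subrK.
    have nm : n%:R * m <= x ^+ 4 * `|m|.
      apply: (@le_trans _ _ (n%:R * `|m|)).
        by rewrite ler_wpM2l ?ler_norm// ltW.
      by rewrite ler_wpM2r// (le_trans nx)// ler_weXn2l.
    have nn : n%:R ^+ 2 <= x ^+ 4.
      by rewrite (exprM x 2 2) lerXn2r ?nnegrE ?exprn_ge0 ?(ltW x0).
    have x4 : x <= x ^+ 4 by rewrite -[leLHS]expr1 ler_weXn2l.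
    have xm : x ^+ 4 * (2 + `|m|) <= x ^+ 5.
      by rewrite [leRHS]exprSr ler_wpM2l ?exprn_ge0 ?(ltW x0)// (le_trans wm).
    by rewrite gE; lra.
  have plow : 2^-1 * (c * (x ^+ 5) `^ (- b)) <= ptail f n (gamma n).
    apply: le_trans (HN1 k (gamma n) _ kN1 gx).
    by rewrite ler_wpM2l// Hc.
  have xb : (x ^+ 5) `^ (- b) = expR (- (5 * b * ln x)).
    rewrite -{1}(lnK x0) -expRM_natl -expRM; congr expR; ring.
  have pup := HK k (gamma n) (u n) _ (Fu n) t0.
  have fu := is_density_trunc _ _ f_density fp _ (Fu n).
  split.
    apply: lt_le_trans plow; rewrite mulr_gt0// mulr_gt0// powR_gt0//.
    exact: exprn_gt0.
  rewrite ger0_norm; last exact: (ptail_ge0 _ fu).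
  apply: (le_trans pup); rewrite -/n -/x.
  have -> : 2 + delta - 2 = delta by ring.
  apply: (@le_trans _ _ (expR (- ((A - 1) * ln x)))); first by rewrite ler_expR.
  rewrite ler_pdivlMr//; apply: le_trans plow; rewrite xb.
  have -> : - ((A - 1) * ln x) = - (5 * b * ln x) + - (2 * ln x).
    by rewrite /A; ring.
  rewrite expRD -(mulrA (expR _)); set E := expR (- (5 * b * ln x)).
  have -> : 2^-1 * (c * E) = E * (c / 2) by field.
  rewrite ler_wpM2l ?expR_ge0//.
  rewrite expRN expRM_natl lnK ?posrE// mulrC ler_pdivrMr ?exprn_gt0//.
  have cx : 2 <= x * c by rewrite -ler_pdivrMr// (le_trans wc).
  apply: (le_trans xw).
  have -> : c / 2 * x ^+ 2 = x * (x * c / 2) by field.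
  by rewrite ler_peMr ?(ltW x0)// ler_pdivlMr// mul1r.
have [N4 HN4] := key.
(* The error is minus the ratio of the two tails, so the identity is exact as soon as [p(F) > 0]. *)
exists (fun n => - (ptail (trunc_density f (u n)) n (gamma n) / ptail f n (gamma n))).
split; last first.
  exists N4 => n /HN4[pn _]; field; rewrite gt_eqF//.
apply/cvgr0Pnorm_le => e e0.
have [N5 HN5] := Hw e^-1.
exists (N4 + N5)%N => // n /= Nn.
have [n4 n5] : (N4 <= n)%N /\ (N5 <= n)%N by clear -Nn; lia.
have [pn hn] := HN4 n n4.
have wn := HN5 n n5.
have w0 : 0 < w n by apply: lt_le_trans wn; rewrite invr_gt0.
rewrite normrN normrM normfV (gtr0_norm pn) ler_pdivrMr//.
apply: (le_trans hn); rewrite mulrC ler_wpM2r ?(ltW pn)//.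
by rewrite -[e]invrK lef_pV2 ?posrE ?invr_gt0.
Qed.
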